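(* Let $\mathcal{H}$ be a complex separable Hilbert space, let $\mathcal{K}$ and $\mathcal{E}$ be complex Krein spaces, let $T:\mathcal{H}\to\mathcal{K}$ and $V:\mathcal{H}\to\mathcal{E}$ be bounded surjective linear operators, and let $\rho\in\mathbb{R}$, $\rho\neq0$. Let $L:\mathcal{H}\to\mathcal{K}\times\mathcal{E}$, $Lx=(Tx,Vx)$, and suppose that $R(L)$ is a positive nondegenerate subspace of $(\mathcal{K}\times\mathcal{E},[\cdot,\cdot]_\rho)$. Then the following conditions hold: (1) for every $z_0\in\mathcal{E}$ such that $sm(\rho,z_0)\neq\varnothing$ there exists $w_0\in\mathcal{E}$ such that $\varnothing\neq sp(w_0)=sm(\rho,z_0)$; (2) for every $w_0\in\mathcal{E}$ such that $sp(w_0)\neq\varnothing$ there exists $z_0\in\mathcal{E}$ such that $sp(w_0)=sm(\rho,z_0)$.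
   Context: A Krein space is a complex vector space $\mathcal{F}$ with a Hermitian sesquilinear form $[\cdot,\cdot]_{\mathcal{F}}$ that admits a fundamental decomposition $\mathcal{F}=\mathcal{F}_+\dotplus\mathcal{F}_-$, where $\mathcal{F}_+$ and $\mathcal{F}_-$ are orthogonal with respect to $[\cdot,\cdot]_{\mathcal{F}}$ and $(\mathcal{F}_+,[\cdot,\cdot])$, $(\mathcal{F}_-,-[\cdot,\cdot])$ are Hilbert spaces. Topological notions refer to the norm of the Hilbert space direct sum of these two spaces (the topology does not depend on the decomposition). $\mathcal{K}\times\mathcal{E}$ carries the indefinite inner product $[(y,z),(y',z')]_\rho=[y,y']_{\mathcal{K}}+\rho[z,z']_{\mathcal{E}}$, which makes it a Krein space since $\rho\ne0$. $R(\cdot)$ denotes the range. A subspace $\mathcal{M}$ is positive if $[x,x]>0$ for all nonzero $x\in\mathcal{M}$, and nondegenerate if $\mathcal{M}\cap\mathcal{M}^{[\perp]}=\{0\}$, where $\mathcal{M}^{[\perp]}=\{x: [x,m]=0\ \forall m\in\mathcal{M}\}$. For $z_0\in\mathcal{E}$, $sm(\rho,z_0)$ is the set of $(T,V,\rho)$-smoothing splines to $z_0$: the set of all $\tilde x\in\mathcal{H}$ at which $\min_{x\in\mathcal{H}}\left([Tx,Tx]_{\mathcal{K}}+\rho[Vx-z_0,Vx-z_0]_{\mathcal{E}}\right)$ is attained (empty if there is no minimum). For $w_0\in\mathcal{E}$, $sp(w_0)$ is the set of $(T,V)$-interpolating splines to $w_0$: the set of all $\tilde x\in\mathcal{H}$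 with $V\tilde x=w_0$ at which $\min\{[Tx,Tx]_{\mathcal{K}}: x\in\mathcal{H},\ Vx=w_0\}$ is attained (empty if there is no minimum). *)

(* Defs.v *)
From HB Require Import structures.
From mathcomp Require Import all_boot all_order all_algebra.
From mathcomp Require Import complex.
From mathcomp Require Import all_classical all_reals all_analysis.

Set Implicit Arguments.
Unset Strict Implicit.
Unset Printing Implicit Defensive.

Import Order.TTheory GRing.Theory Num.Theory.
Import numFieldNormedType.Exports.

Local Open Scope classical_set_scope.
Local Open Scope ring_scope.
Local Open Scope complex_scope.

(* A sesquilinear form is linear in its first argument, as for
   [{hermitian_sym U for Num.conj}]. The order of [R[i]] relates only numbers
   with the same imaginary part; the values [B x x] of a Hermitian form are real,
   so on them it is the order of [R]. *)

Section Spaces.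
Variable R : realType.
Implicit Type U : lmodType R[i].

Definition linear_subspace U (M : set U) : Prop :=
  M 0 /\ forall (a : R[i]) (x y : U), M x -> M y -> M (a *: x + y).

Definition positive_subspace U (B : U -> U -> R[i]) (M : set U) : Prop :=
  linear_subspace M /\ forall x : U, M x -> x != 0 -> 0 < B x x.

Definition orthogonal_companion U (B : U -> U -> R[i]) (M : set U) : set U :=
  [set x | forall m : U, M m -> B x m = 0].

Definition nondegenerate_subspace U (B : U -> U -> R[i]) (M : set U) : Prop :=
  linear_subspace M /\ M `&` orthogonal_companion B M = [set 0].

Definition form_norm U (B : U -> U -> R[i]) (x : U) : R[i] := sqrtC (B x x).

Definition hilbert_subspace U (B : U -> U -> R[i]) (M : set U) : Prop :=
  positive_subspace B M /\
  forall u : nat -> U, (forall n, M (u n)) ->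
    (forall e : R, 0 < e ->
       \forall m & n \near \oo, form_norm B (u m - u n) < e%:C) ->
    exists2 l : U, M l &
      forall e : R, 0 < e -> \forall n \near \oo, form_norm B (u n - l) < e%:C.

Definition fundamental_decomposition U (B : U -> U -> R[i])
    (P N : set U) : Prop :=
  [/\ forall x : U, exists p n : U, [/\ P p, N n & x = p + n],
      P `&` N = [set 0],
      forall p n : U, P p -> N n -> B p n = 0,
      hilbert_subspace B P
    & hilbert_subspace (fun x y => - B x y) N].

(* The norm carried by [F] supplies the topology: it is the norm of the Hilbert
   space direct sum of the components of a fundamental decomposition. Every
   vector space with a Hermitian form admitting such a decomposition carries
   such a norm. *)
Definition krein_space (F : normedModType R[i])
    (B : {hermitian_sym F for Num.conj}) : Prop :=
  exists P N : set F, fundamental_decomposition B P N /\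
    forall p n : F, P p -> N n -> `|p + n| ^+ 2 = B p p - B n n.

(* For [H : completeNormedModType R[i]] this makes [H] a Hilbert space. *)
Definition inner_product_norm (H : normedModType R[i])
    (ip : {dot H for Num.conj}) : Prop :=
  forall x : H, `|x| ^+ 2 = ip x x.

Definition separable (X : topologicalType) : Prop :=
  exists D : set X, countable D /\ dense D.

Definition bounded_operator (X Y : normedModType R[i]) (f : X -> Y) : Prop :=
  exists M : R[i], forall x : X, `|f x| <= M * `|x|.

End Spaces.

Section Splines.
Variables (R : realType) (H K E : lmodType R[i]).
Variables (BK : K -> K -> R[i]) (BE : E -> E -> R[i]) (rho : R).
Variables (T : H -> K) (V : H -> E).

Definition form_rho (u v : K * E) : R[i] :=
  BK u.1 v.1 + rho%:C * BE u.2 v.2.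

Definition pair_op (x : H) : K * E := (T x, V x).

Definition minimizers (A : set H) (f : H -> R[i]) : set H :=
  [set x | A x /\ forall y : H, A y -> f x <= f y].

Definition smoothing_splines (z0 : E) : set H :=
  minimizers setT
    (fun x => BK (T x) (T x) + rho%:C * BE (V x - z0) (V x - z0)).

Definition interpolating_splines (w0 : E) : set H :=
  minimizers [set x | V x = w0] (fun x => BK (T x) (T x)).

End Splines.

(* Main.v *)
(* Everything is reduced to real parts of the forms, i.e. to real symmetric
   bilinear forms. By positivity of R(L), x minimises iff the first-order
   condition holds, and each nonempty spline set is then the fibre
   {y | Ty = Tx, Vy = Vx} of L through any of its points. A smoothing spline x
   interpolates w0 = Vx. Conversely, if x interpolates, h |-> [Th, Tx] vanishes
   on ker V; since V is onto, it equals [Vh, a] for some a in E, and x is a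
   smoothing spline to z0 = Vx + a / rho.

   The representing vector a comes from the Riesz theorem applied twice: in H,
   to get the adjoint W : E -> H of V, and in E with the form <Wz, Wz'>. That
   form is complete because W is bounded below, a uniform boundedness statement
   proved by a gliding hump. *)
Require Import Defs.
From HB Require Import structures.
From mathcomp Require Import all_boot all_order all_algebra.
From mathcomp Require Import complex.
From mathcomp Require Import all_classical all_reals all_analysis.
From mathcomp Require Import ring lra.

Set Implicit Arguments.
Unset Strict Implicit.
Unset Printing Implicit Defensive.

Import Order.TTheory GRing.Theory Num.Theory.
Import numFieldNormedType.Exports.

Local Open Scope classical_set_scope.
Local Open Scope ring_scope.
Local Open Scope complex_scope.

(** * Real symmetric bilinear forms and Riesz representation *)

Section RealForms.
Variables (R : realType) (U : lmodType R[i]).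

Definition real_linear (f : U -> R) : Prop :=
  forall (r : R) (x y : U), f (r%:C *: x + y) = r * f x + f y.

Definition real_form (b : U -> U -> R) : Prop :=
  (forall y, real_linear (b^~ y)) /\ forall x y, b x y = b y x.

(** Here [q] is meant as a squared norm, so that no square roots enter. *)
Definition cauchy_complete (q : U -> R) : Prop :=
  forall u : nat -> U,
    (forall e : R, 0 < e -> \forall m & n \near \oo, q (u m - u n) < e) ->
    exists l : U, forall e : R, 0 < e -> \forall n \near \oo, q (u n - l) < e.

Section LinearTheory.
Variable f : U -> R.
Hypothesis fL : real_linear f.

Lemma real_linearD x y : f (x + y) = f x + f y.
Proof. by rewrite -[x in LHS]scale1r (fL 1) mul1r. Qed.

Lemma real_linear0 : f 0 = 0.
Proof. by apply: (addrI (f 0)); rewrite -real_linearD !addr0. Qed.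

Lemma real_linearZ r x : f (r%:C *: x) = r * f x.
Proof. by rewrite -[_ *: _]addr0 fL real_linear0 addr0. Qed.

Lemma real_linearN x : f (- x) = - f x.
Proof. by apply: (addrI (f x)); rewrite -real_linearD !subrr real_linear0. Qed.

Lemma real_linearB x y : f (x - y) = f x - f y.
Proof. by rewrite real_linearD real_linearN. Qed.

End LinearTheory.

Lemma real_formr b y : real_form b -> real_linear (b y).
Proof. by move=> [bL bC] r u v; rewrite bC bL !(bC y). Qed.

Lemma real_form_expand b x y r : real_form b ->
  b (x + r%:C *: y) (x + r%:C *: y) =
  b x x + 2 * r * b x y + r ^+ 2 * b y y.
Proof.
move=> bF; have [bL bC] := bF.
rewrite (real_linearD (bL _)) (real_linearZ (bL _)).
rewrite !(real_linearD (real_formr _ bF)) !(real_linearZ (real_formr _ bF)).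
by rewrite (bC y x); ring.
Qed.

Lemma le_small_eq0 (a c : R) :
  (forall t, 0 < t -> t * `|a| <= t ^+ 2 * c) -> a = 0.
Proof.
move=> h; apply/eqP; rewrite -normr_le0; apply/ler_addgt0Pl => e e0; rewrite addr0.
have c0 : 0 <= c by have := h 1 ltr01; rewrite mul1r expr1n mul1r; apply: le_trans.
(* The [+ 1] keeps the denominator positive when [c = 0], and [t * c <= e] still holds. *)
have t0 : 0 < e / (c + 1) by rewrite divr_gt0// ltr_wpDl.
have := h _ t0; rewrite expr2 -mulrA ler_pM2l// => /le_trans; apply.
by rewrite mulrAC ler_pdivrMr ?ltr_wpDl// ler_pM2l// lerDl.
Qed.

Lemma quadratic_min (a c : R) :
  (forall r, 0 <= 2 * r * a + r ^+ 2 * c) -> a = 0.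
Proof.
move=> h; apply: (@le_small_eq0 _ c) => t t0; have := h t; have := h (- t).
by case: (ltrP a 0) => [/ltr0_norm ->|/ger0_norm ->]; nra.
Qed.

(* Minimise [b x x - 2 f x], which is at least [- c]: by the parallelogram
   identity every minimising sequence is Cauchy, and its limit represents [f]. *)
Lemma riesz b (f : U -> R) c : real_form b -> (forall x, 0 <= b x x) ->
  cauchy_complete (fun x => b x x) -> real_linear f ->
  (forall x, 2 * f x <= b x x + c) ->
  exists a, forall x, f x = b x a.
Proof.
move=> bF b0 bcomp fL fb; have [bL bC] := bF.
pose J x := b x x - 2 * f x.
have Jlb : has_inf (range J).
  split; first by exists (J 0), 0.
  by exists (- c) => _ [x _ <-]; rewrite /J; have := fb x; lra.
pose d := inf (range J).
have dJ x : d <= J x by apply: ge_inf; [case: Jlb | exists x].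
have /choice[u uP] : forall n : nat, exists x, J x < d + n.+1%:R^-1.
  move=> n; have n0 : 0 < n.+1%:R^-1 :> R by rewrite invr_gt0.
  by have [_ [x _ <-] Jx] := inf_adherent n0 Jlb; exists x.
have un e : 0 < e -> \forall n \near \oo, J (u n) < d + e.
  move=> e0; near=> n; apply: lt_trans (uP n) _; rewrite ltrD2l.
  by near: n; exact: (near_infty_natSinv_lt (PosNum e0)).
have [e e0|l ul] := bcomp u.
  near=> m n.
  have Jm : J (u m) < d + e / 4 by near: m; apply: un; rewrite divr_gt0.
  have Jn : J (u n) < d + e / 4 by near: n; apply: un; rewrite divr_gt0.
  (* The argument is the midpoint of [u m] and [u n], in the shape [real_form_expand] needs. The
     squared distance is [2 * (J (u m) + J (u n) - 2 * J mid)], whence [e / 4] above. *)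
  have : d <= J (u m + (- 2^-1)%:C *: (u m + (-1)%:C *: u n)) by [].
  move: Jm Jn; have -> : u m - u n = u m + (-1)%:C *: u n.
    by rewrite rmorphN scaleN1r.
  rewrite /J !(real_form_expand, real_linearD fL, real_linearZ fL)//.
  rewrite (real_linearD (real_formr _ bF)) (real_linearZ (real_formr _ bF)).
  lra.
exists l => v; apply/eqP; rewrite eq_sym -subr_eq0; apply/eqP.
apply: (@le_small_eq0 _ (b v v)) => t t0.
apply/ler_addgt0Pl => e e0.
near \oo => n.
have Jn : J (u n) < d + e by near: n; apply: un.
have ln : b (u n - l) (u n - l) < e by near: n; apply: ul.
(* Near-minimality bounds [2 * t * |b (u n) v - f v|] by [e + t ^+ 2 * b v v]. Nonnegativity of [b]
   at [u n - l +- t v] bounds [2 * t * |b (u n - l) v|] likewise. The two bounds add up to the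
   claim. *)
have := dJ (u n + t%:C *: v); have := dJ (u n + (- t)%:C *: v).
have := b0 (u n - l + t%:C *: v); have := b0 (u n - l + (- t)%:C *: v).
move: Jn; rewrite /J !(real_form_expand, real_linearD fL, real_linearZ fL)//.
rewrite (bC v) (real_linearB (bL v)).
by case: (ltrP (b l v - f v) 0) => [/ltr0_norm ->|/ger0_norm ->]; nra.
Unshelve. all: by end_near. Qed.

End RealForms.

(** * Real parts of Hermitian forms and real-valued norms *)

Section RealPart.
Variable R : realType.

Definition re_form (U : lmodType R[i]) (B : U -> U -> R[i]) (x y : U) : R :=
  complex.Re (B x y).

(** The norm takes values in [R[i]]; its copy in [R] is totally ordered and open to [lra] and
    [nra]. *)
Definition rnorm (F : normedModType R[i]) (x : F) : R := complex.Re `|x|.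

Lemma ReZ (r : R) (z : R[i]) : complex.Re (r%:C * z) = r * complex.Re z.
Proof. by case: z => a b /=; rewrite mul0r subr0. Qed.

Lemma re_form_real (U : lmodType R[i]) (B : {hermitian_sym U for Num.conj}) :
  real_form (re_form B).
Proof.
split=> [y r x z|x y]; rewrite /re_form.
  by rewrite linearDl linearZl_LR raddfD /= ReZ.
by rewrite hermC expr0 mul1r; apply: complexI; rewrite !complexRe Re_conj.
Qed.

Lemma herm_real (U : lmodType R[i]) (B : {hermitian_sym U for Num.conj}) x :
  B x x = (re_form B x x)%:C.
Proof.
by rewrite RRe_real//; apply/CrealP; rewrite [RHS]hermC expr0 mul1r.
Qed.

Section Norm.
Variable F : normedModType R[i].
Implicit Types x y : F.

Lemma rnormE x : `|x| = (rnorm x)%:C.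
Proof. by rewrite [RHS]RRe_real// normr_real. Qed.

Lemma rnorm_ge0 x : 0 <= rnorm x.
Proof. by rewrite -lecR -rnormE normr_ge0. Qed.

Lemma rnormD x y : rnorm (x + y) <= rnorm x + rnorm y.
Proof. by rewrite -lecR rmorphD /= -!rnormE; exact: ler_normD. Qed.

Lemma rnormZ r x : rnorm (r%:C *: x) = `|r| * rnorm x.
Proof.
apply: complexI; rewrite rmorphM /= -!rnormE normrZ; congr (_ * _).
by rewrite normc_def /= expr0n addr0 sqrtr_sqr.
Qed.

Lemma rnorm_sqr x : (rnorm x ^+ 2)%:C = `|x| ^+ 2.
Proof. by rewrite rmorphXn /= -rnormE. Qed.

Lemma rnorm0_eq0 x : rnorm x = 0 -> x = 0.
Proof. by move=> x0; apply/normr0_eq0; rewrite rnormE x0. Qed.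

Lemma rnorm_distC x y : rnorm (x - y) = rnorm (y - x).
Proof. by rewrite /rnorm distrC. Qed.

End Norm.

Lemma rnorm_bounded (X Y : normedModType R[i]) (f : X -> Y) :
  bounded_operator f ->
  exists2 s : R, 0 < s & forall x, rnorm (f x) <= s * rnorm x.
Proof.
move=> [M fM]; exists (complex.Re `|M| + 1).
  by rewrite ltr_wpDl// -ler0c RRe_real ?normr_ge0 ?normr_real.
move=> x; rewrite -lecR rmorphM rmorphD /= RRe_real ?normr_real//.
rewrite -!rnormE.
(* The constant [M] may be any complex number, but [M * |x|] dominates a norm, so it is its own
   absolute value. *)
have Mx : 0 <= M * `|x| := le_trans (normr_ge0 _) (fM x).
apply: (le_trans (fM x)); rewrite -(ger0_norm Mx) normrM normr_id.
by rewrite ler_wpM2r ?normr_ge0// lerDl.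
Qed.

Lemma form_norm_lt (U : lmodType R[i]) (B : U -> U -> R[i]) x e :
  0 <= B x x -> 0 < e -> (form_norm B x < e%:C) = (re_form B x x < e ^+ 2).
Proof.
move=> B0 e0; have e0' : 0 <= e%:C by rewrite lecR ltW.
rewrite /form_norm -(sqrCK e0') ltr_sqrtC ?nnegrE ?exprn_ge0//.
have -> : B x x = (re_form B x x)%:C by rewrite RRe_real// ger0_real.
by rewrite -rmorphXn /= ltcR.
Qed.

End RealPart.

(** * Completeness and Cauchy-Schwarz inequalities *)

Section Completeness.
Variable R : realType.

Lemma complete_rnorm (H : completeNormedModType R[i]) :
  cauchy_complete (fun x : H => rnorm x ^+ 2).
Proof.
move=> u uc.
have /cauchy_cvgP/cvg_ex[l ul] : cauchy (u @ \oo).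
  apply/cauchy_ballP => e e0.
  have eR : e = (complex.Re e)%:C by rewrite RRe_real// gtr0_real.
  have r0 : 0 < complex.Re e by rewrite -ltcR -eR.
  have r20 : 0 < complex.Re e ^+ 2 by rewrite exprn_gt0.
  rewrite near_simpl; apply: filterS (uc _ r20) => -[m n] /= umn.
  rewrite -ball_normE /= rnormE eR ltcR.
  by rewrite -ltr_sqr ?nnegrE ?rnorm_ge0 ?(ltW r0).
exists l => e e0.
have s0 : 0 < Num.sqrt e by rewrite sqrtr_gt0.
have /cvgrPdist_lt/(_ (Num.sqrt e)%:C) := ul; rewrite ltcR => /(_ s0).
apply: filterS => n; rewrite rnormE ltcR rnorm_distC => h.
by rewrite -(sqr_sqrtr (ltW e0)) ltr_sqr ?nnegrE ?rnorm_ge0 ?(ltW s0).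
Qed.

(** [B] is a bare function so that [fun x y => - B x y], the form on the negative component, is
    covered too. *)
Lemma positive_subspace_ge0 (U : lmodType R[i]) (B : U -> U -> R[i]) (M : set U) :
  B 0 0 = 0 -> positive_subspace B M -> forall x, M x -> 0 <= B x x.
Proof.
move=> B0 [_ pos] x Mx; have [->|x0] := eqVneq x 0; first by rewrite B0.
exact/ltW/pos.
Qed.

Lemma hilbert_subspace_complete (U : lmodType R[i]) (B : U -> U -> R[i])
    (M : set U) (u : nat -> U) :
  B 0 0 = 0 -> hilbert_subspace B M -> (forall n, M (u n)) ->
  (forall e : R, 0 < e ->
     \forall m & n \near \oo, re_form B (u m - u n) (u m - u n) < e) ->
  exists2 l : U, M l &
    forall e : R, 0 < e -> \forall n \near \oo, re_form B (u n - l) (u n - l) < e.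
Proof.
move=> B0 [Mpos Mcomp] Mu uc; have Bge0 := positive_subspace_ge0 B0 Mpos.
have [[M0 ML] _] := Mpos.
have MB x y : M x -> M y -> M (x - y).
  by move=> Mx My; have := ML (-1) y x My Mx; rewrite scaleN1r addrC.
have [e e0|l Ml ul] := Mcomp _ Mu.
  have e20 : 0 < e ^+ 2 by rewrite exprn_gt0.
  apply: filterS (uc _ e20) => -[m n] /= umn.
  by rewrite form_norm_lt//; apply/Bge0/MB.
exists l => // e e0; have s0 : 0 < Num.sqrt e by rewrite sqrtr_gt0.
apply: filterS (ul _ s0) => n.
by rewrite form_norm_lt ?sqr_sqrtr ?(ltW e0)//; apply/Bge0/MB.
Qed.

Lemma young_cauchy_schwarz (F : normedModType R[i]) (b : F -> F -> R) :
  real_form b -> (forall x y, 2 * b x y <= rnorm x ^+ 2 + rnorm y ^+ 2) ->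
  forall x y, `|b x y| <= rnorm x * rnorm y.
Proof.
move=> BF young x y.
have half u v : b u v <= rnorm u * rnorm v.
  have [u0|u0] := eqVneq (rnorm u) 0.
    by rewrite (rnorm0_eq0 u0) (real_linear0 (BF.1 _)) mulr_ge0 ?rnorm_ge0.
  have [v0|v0] := eqVneq (rnorm v) 0.
    rewrite (rnorm0_eq0 v0) (real_linear0 (real_formr u BF)).
    by rewrite mulr_ge0 ?rnorm_ge0.
  have u_gt0 : 0 < rnorm u by rewrite lt0r u0 rnorm_ge0.
  have v_gt0 : 0 < rnorm v by rewrite lt0r v0 rnorm_ge0.
  have := young ((rnorm v / rnorm u)%:C *: u) v.
  rewrite (real_linearZ (BF.1 _)) rnormZ ger0_norm ?divr_ge0 ?rnorm_ge0//.
  rewrite divfK// => h.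
  have e1 : 2 * (rnorm v / rnorm u * b u v) <= 2 * rnorm v ^+ 2 by lra.
  move: e1; rewrite ler_pM2l// mulrAC ler_pdivrMr// expr2 -mulrA ler_pM2l//.
  by rewrite mulrC.
rewrite ler_norml half andbT lerNl -(real_linearN (BF.1 _)).
by rewrite -[rnorm x]mul1r -normr1 -normrN -rnormZ rmorphN scaleN1r.
Qed.

Section Krein.
Variables (F : normedModType R[i]) (B : {hermitian_sym F for Num.conj}).
Hypothesis B_krein : krein_space B.

(** [J] is the fundamental symmetry [p + n |-> p - n]; pairing with it recovers the norm from the
    indefinite form. *)
Lemma krein_symmetry : exists J : F -> F,
  forall z, rnorm (J z) = rnorm z /\ re_form B (J z) z = rnorm z ^+ 2.
Proof.
have [P [N [[dec _ orth [[[P0 PL] _] _] [[[N0 NL] _] _]] nrm]]] := B_krein.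
suff /choice[J JP] : forall z, exists w,
  rnorm w = rnorm z /\ re_form B w z = rnorm z ^+ 2 by exists J.
move=> z; have [p [n [Pp Nn ->]]] := dec z; exists (p - n).
have NNn : N (- n) by have := NL (-1) n 0 Nn N0; rewrite addr0 scaleN1r.
have pnE : B p n = 0 by exact: orth.
have npE : B n p = 0 by rewrite hermC pnE rmorph0 mulr0.
split.
  apply/eqP; rewrite -(@eqrXn2 _ 2) ?rnorm_ge0//; apply/eqP.
  apply: complexI; rewrite !rnorm_sqr !nrm//.
  by rewrite linearNl linearNr opprK.
have BF := re_form_real B; have Br := real_formr _ BF; have Bl := BF.1.
apply: complexI; rewrite rnorm_sqr nrm// (real_linearB (Bl _)).
rewrite !(real_linearD (Br _)) {2}/re_form pnE {2}/re_form npE.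
by rewrite !raddf0 add0r addr0 rmorphB /= -!herm_real.
Qed.

(** With [x = p + n] and [y = p' + n'], add the inequalities [0 <= B (p - p') (p - p')] and
    [0 <= - B (n + n') (n + n')]. The opposite signs inside make both cross terms bound [B x y] from
    above. *)
Lemma krein_young x y : 2 * re_form B x y <= rnorm x ^+ 2 + rnorm y ^+ 2.
Proof.
have [P [N [[dec _ orth [[[P0 PL] Ppos] _] [[[N0 NL] Npos] _]] nrm]]] := B_krein.
have [p [n [Pp Nn ->]]] := dec x; have [p' [n' [Pp' Nn' ->]]] := dec y.
have Re2 u v : P u -> N v -> rnorm (u + v) ^+ 2 = re_form B u u - re_form B v v.
  by move=> Pu Nv; apply: complexI; rewrite rnorm_sqr nrm// rmorphB /= -!herm_real.
have BF := re_form_real B; have Br := real_formr _ BF; have Bl := BF.1.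
have pn : re_form B p n' = 0 by rewrite /re_form orth.
have np : re_form B n p' = 0 by rewrite BF.2 /re_form orth.
have pos u v : P u -> P v -> 0 <= re_form B (u - v) (u - v).
  move=> Pu Pv; have := PL (-1) v u Pv Pu; rewrite scaleN1r addrC => Puv.
  have [->|uv] := eqVneq (u - v) 0; first by rewrite (real_linear0 (Br _)).
  by rewrite -ler0c -herm_real ltW// Ppos.
have neg u v : N u -> N v -> re_form B (u + v) (u + v) <= 0.
  move=> Nu Nv; have := NL 1 u v Nu Nv; rewrite scale1r => Nuv.
  have [->|uv] := eqVneq (u + v) 0; first by rewrite (real_linear0 (Br _)).
  by rewrite -oppr_ge0 -ler0c rmorphN /= -herm_real ltW// Npos.
have := pos _ _ Pp Pp'; have := neg _ _ Nn Nn'.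
rewrite !Re2// !(real_linearB (Br _), real_linearD (Br _)).
rewrite !(real_linearB (Bl _), real_linearD (Bl _)) pn np.
rewrite (BF.2 p' p) (BF.2 n' n); lra.
Qed.

Lemma krein_cauchy_schwarz x y : `|re_form B x y| <= rnorm x * rnorm y.
Proof. exact: young_cauchy_schwarz (re_form_real B) krein_young x y. Qed.

(** The squared distance is a sum of two nonnegative terms, one for each component, so the
    components of a Cauchy sequence are Cauchy and converge separately. *)
Lemma krein_complete : cauchy_complete (fun x : F => rnorm x ^+ 2).
Proof.
have [P [N [[dec _ _ HP HN] nrm]]] := B_krein; move=> u uc.
pose B' x y := - B x y.
have B00 : B 0 0 = 0 by rewrite linear0l.
have B'00 : B' 0 0 = 0 by rewrite /B' B00 oppr0.
have PB x y : P x -> P y -> P (x - y).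
  have [[[_ PL] _] _] := HP.
  by move=> Px Py; have := PL (-1) y x Py Px; rewrite scaleN1r addrC.
have NB x y : N x -> N y -> N (x - y).
  have [[[_ NL] _] _] := HN.
  by move=> Nx Ny; have := NL (-1) y x Ny Nx; rewrite scaleN1r addrC.
have Pge0 x : P x -> 0 <= re_form B x x.
  by move=> Px; rewrite -ler0c -herm_real (positive_subspace_ge0 B00 HP.1).
have Nge0 x : N x -> 0 <= re_form B' x x.
  have -> : re_form B' x x = - re_form B x x by rewrite /re_form /B' raddfN.
  move=> Nx; rewrite -ler0c rmorphN /= -herm_real.
  exact: (positive_subspace_ge0 B'00 HN.1).
have split2 p p' n n' : P p -> P p' -> N n -> N n' ->
    rnorm (p + n - (p' + n')) ^+ 2 =
    re_form B (p - p') (p - p') + re_form B' (n - n') (n - n').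
  move=> Pp Pp' Nn Nn'; rewrite opprD addrACA; apply: complexI.
  rewrite rnorm_sqr nrm; [|exact: PB|exact: NB].
  have -> : re_form B' (n - n') (n - n') = - re_form B (n - n') (n - n').
    by rewrite /re_form /B' raddfN.
  by rewrite rmorphB /= -!herm_real.
have /choice[p /choice[n pn]] : forall k, exists p n, [/\ P p, N n & u k = p + n].
  by move=> k; apply: dec.
have Pp k : P (p k) by have [] := pn k.
have Nn k : N (n k) by have [] := pn k.
have uE k : u k = p k + n k by have [] := pn k.
have [e e0|lp Plp plp] := hilbert_subspace_complete B00 HP Pp.
  apply: filterS (uc _ e0) => -[i j] /=; rewrite !uE split2//.
  by apply: le_lt_trans; rewrite lerDl; apply/Nge0/NB.
have [e e0|ln Nln nln] := hilbert_subspace_complete B'00 HN Nn.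
  apply: filterS (uc _ e0) => -[i j] /=; rewrite !uE split2//.
  by apply: le_lt_trans; rewrite lerDr; apply/Pge0/PB.
exists (lp + ln) => e e0; have e20 : 0 < e / 2 by rewrite divr_gt0.
near=> k; rewrite uE split2// (splitr e) ltrD//.
  by near: k; exact: plp.
by near: k; exact: nln.
Unshelve. all: by end_near. Qed.

End Krein.
End Completeness.

(** * A gliding hump for a sequence of functionals *)

Section GlidingHump.
Variables (R : realType) (F : normedModType R[i]).
Hypothesis F_complete : cauchy_complete (fun x : F => rnorm x ^+ 2).

(* Sokal's gliding hump: [x_(n+1) = x_n +- 3^-(n+1) y_n], the sign being chosen so
   that [g_n] is at least [3^-(n+1)] there; all later steps move by at most half
   of that. *)
Lemma gliding_hump (g : nat -> F -> R) (y : nat -> F) :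
  (forall n, real_linear (g n)) -> (forall n x, `|g n x| <= rnorm x) ->
  (forall n, rnorm (y n) = 1) -> (forall n, g n (y n) = 1) ->
  exists x, forall n, 3^-1 ^+ n.+1 / 2 <= `|g n x|.
Proof.
move=> gL gle y1 gy; pose w n : R := 3^-1 ^+ n.
have w_gt0 n : 0 < w n by rewrite exprn_gt0.
have wS n : w n = 3 * w n.+1 by rewrite /w exprS mulrA divff// mul1r.
pose step n x := let v := (w n.+1)%:C *: y n in
  if w n.+1 <= `|g n (x + v)| then x + v else x - v.
have stepn n x : rnorm (step n x - x) = w n.+1.
  have v1 : rnorm ((w n.+1)%:C *: y n) = w n.+1.
    by rewrite rnormZ y1 mulr1 gtr0_norm.
  rewrite /step; case: ifP => _; first by rewrite addrAC subrr add0r.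
  by rewrite addrAC subrr add0r /rnorm normrN -/(rnorm _).
have stepg n x : w n.+1 <= `|g n (step n x)|.
  rewrite /step; case: ifPn => //; rewrite -ltNge.
  (* If the plus sign fails, then [g n x < 0], and subtracting [v] moves the value further from
     zero. *)
  rewrite (real_linearD (gL n)) (real_linearB (gL n)) (real_linearZ (gL n)) gy.
  rewrite mulr1 ltr_norml => /andP[_ h].
  by rewrite ler_normr; apply/orP; right; move: h; lra.
pose fix x n := if n is m.+1 then step m (x m) else 0.
(* The right side is the geometric sum of the step lengths [w n.+1, ..., w (n + k)]. *)
have tail n k : rnorm (x (n + k)%N - x n) <= (w n - w (n + k)%N) / 2.
  elim: k => [|k IH]; first by rewrite addn0 !subrr mul0r /rnorm normr0.
  rewrite addnS [x _.+1]/= -(subrKA (x (n + k)%N)).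
  apply: le_trans (rnormD _ _) _; rewrite stepn.
  by move: IH; rewrite (wS (n + k)%N); lra.
have tailw n k : (n <= k)%N -> rnorm (x k - x n) <= w n / 2.
  move=> nk; have := tail n (k - n)%N; rewrite subnKC// => /le_trans; apply.
  by rewrite ler_pM2r ?invr_gt0// gerBl ltW.
have wlim e : 0 < e -> \forall n \near \oo, w n < e.
  move=> e0; have w0 : w @ \oo --> 0.
    by apply: cvg_expr; rewrite gtr0_norm ?invf_lt1 ?ltr1n.
  have /cvgrPdist_lt/(_ _ e0) := w0; apply: filterS => n.
  by rewrite sub0r normrN gtr0_norm.
have [e e0|l xl] := F_complete (u := x).
  have s0 : 0 < Num.sqrt e by rewrite sqrtr_gt0.
  have [N _ /(_ N (leqnn _)) /= wN] := wlim _ s0.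
  exists ([set k | (N <= k)%N], [set k | (N <= k)%N]) => [|[m n] /= [Nm Nn]].
    by split; exact: nbhs_infty_ge.
  rewrite -(sqr_sqrtr (ltW e0)) ltr_sqr ?nnegrE ?rnorm_ge0 ?(ltW s0)//.
  apply: le_lt_trans wN; rewrite -(subrKA (x N)).
  apply: le_trans (rnormD _ _) _; rewrite (rnorm_distC (x N)).
  by move: (tailw _ _ Nm) (tailw _ _ Nn); lra.
exists l => n; rewrite -/(w _).
apply/ler_addgt0Pr => e e0; near \oo => k.
have kn : (n.+1 <= k)%N by near: k; exact: nbhs_infty_ge.
have := tailw _ _ kn.
have xkl : rnorm (x k - l) < e.
  rewrite -ltr_sqr ?nnegrE ?rnorm_ge0 ?(ltW e0)//.
  by near: k; apply: xl; rewrite exprn_gt0.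
have := stepg n (x n); rewrite -/(x n.+1).
have := gle n (x k - l); have := gle n (x k - x n.+1).
rewrite !(real_linearB (gL n)) => h1 h2 h3 h4.
(* From [x n.+1] to [l] the value of [g n] changes by at most [w n.+1 / 2 + e], through the
   intermediate point [x k]. *)
have := ler_normB (g n (x k) - g n l) (g n (x k) - g n (x n.+1)).
have := ler_normD (g n l) (g n (x n.+1) - g n l).
rewrite addrC subrK.
have -> : g n (x k) - g n l - (g n (x k) - g n (x n.+1)) =
    g n (x n.+1) - g n l by ring.
by move: h1 h2 h3 h4 xkl; lra.
Unshelve. all: by end_near. Qed.

End GlidingHump.

(** * The adjoint of a surjection and functionals vanishing on its kernel *)

Section SurjectiveOperator.
Variables (R : realType) (H : completeNormedModType R[i]).
Variables (ip : {dot H for Num.conj}) (E : normedModType R[i]).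
Variables (BE : {hermitian_sym E for Num.conj}) (V : {linear H -> E}).
Hypotheses (H_hilbert : inner_product_norm ip) (E_krein : krein_space BE).
Hypotheses (V_bounded : bounded_operator V).
Hypothesis V_surj : set_surj [set: H] [set: E] V.

Lemma re_ip_norm x : re_form ip x x = rnorm x ^+ 2.
Proof. by apply: complexI; rewrite -herm_real rnorm_sqr H_hilbert. Qed.

Lemma re_ip_complete : cauchy_complete (fun x => re_form ip x x).
Proof.
have -> : (fun x => re_form ip x x) = (fun x => rnorm x ^+ 2).
  by apply/funext => x; rewrite re_ip_norm.
exact: complete_rnorm.
Qed.

Lemma hilbert_young x y : 2 * re_form ip x y <= rnorm x ^+ 2 + rnorm y ^+ 2.
Proof.
have := sqr_ge0 (rnorm (x + (-1)%:C *: y)).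
rewrite -!re_ip_norm real_form_expand; first lra.
exact: re_form_real.
Qed.

Lemma hilbert_cauchy_schwarz x y : `|re_form ip x y| <= rnorm x * rnorm y.
Proof.
exact: young_cauchy_schwarz (re_form_real ip) hilbert_young x y.
Qed.

Lemma riesz_rnorm (f : H -> R) k : real_linear f ->
  (forall h, f h <= k * rnorm h) -> exists a, forall h, f h = re_form ip h a.
Proof.
move=> fL fk; apply: (@riesz _ _ _ _ (k ^+ 2)) => //.
- exact: re_form_real.
- by move=> x; rewrite re_ip_norm sqr_ge0.
- exact: re_ip_complete.
- move=> x; rewrite re_ip_norm; have := fk x.
  (* The constant [k ^+ 2] comes from [2 * k * |x| <= |x| ^+ 2 + k ^+ 2]. *)
  by have := sqr_ge0 (rnorm x - k); nra.
Qed.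

Lemma surj_adjoint : exists W : E -> H,
  forall h z, re_form BE (V h) z = re_form ip h (W z).
Proof.
have [s s0 Vs] := rnorm_bounded V_bounded.
suff /choice[W WP] : forall z, exists w,
  forall h, re_form BE (V h) z = re_form ip h w by exists W.
move=> z; apply: (@riesz_rnorm _ (s * rnorm z)) => [r x y|h].
  by rewrite linearP /= (re_form_real BE).1.
apply: le_trans (ler_norm _) _; apply: le_trans (krein_cauchy_schwarz _ _ _) _ => //.
by rewrite mulrAC ler_wpM2r ?rnorm_ge0.
Qed.

(** Otherwise some [z n] have relatively tiny images under [W]. The gliding hump for the functionals
    [[., z n] / |z n|] gives an [x] on which they are not that small, and a preimage [h] of [x]
    under [V] would have infinite norm. *)
Lemma adjoint_bounded_below (W : E -> H) :
  (forall h z, re_form BE (V h) z = re_form ip h (W z)) ->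
  exists2 c : R, 0 < c & forall z, c * rnorm z <= rnorm (W z).
Proof.
move=> WP; apply: contrapT => Wsmall.
have BF := re_form_real BE.
(* The hump's lower bound divided by [n.+1], so that the quotient of the two forces
   [n.+1 <= rnorm h]. *)
pose c n : R := 3^-1 ^+ n.+1 / 2 / n.+1%:R.
have c0 n : 0 < c n by rewrite !divr_gt0// exprn_gt0.
have /choice[z zP] : forall n, exists z, rnorm (W z) < c n * rnorm z.
  move=> n; apply: contrapT => h; apply: Wsmall; exists (c n) => // z.
  by rewrite leNgt; apply/negP => zW; apply: h; exists z.
have z0 n : 0 < rnorm (z n).
  by rewrite -(pmulr_rgt0 _ (c0 n)); apply: le_lt_trans (zP n); exact: rnorm_ge0.
have [J JP] := krein_symmetry E_krein.
pose g n x := re_form BE x (z n) / rnorm (z n).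
have [||n|n|x gx] := gliding_hump (krein_complete E_krein) (g := g)
  (y := fun n => ((rnorm (z n))^-1)%:C *: J (z n)).
- by move=> n r x y; rewrite /g BF.1 mulrDl mulrA.
- move=> n x; rewrite normrM normfV (gtr0_norm (z0 n)) ler_pdivrMr//.
  exact: krein_cauchy_schwarz.
- by rewrite rnormZ (JP _).1 gtr0_norm ?invr_gt0// mulVf// gt_eqF.
- by rewrite /g (real_linearZ (BF.1 _)) (JP _).2 expr2 mulKf ?divff// gt_eqF//.
have [h _ hx] := V_surj (I : [set: E] x).
have hn n : n.+1%:R <= rnorm h.
  have w0 : 0 < 3^-1 ^+ n.+1 / 2 :> R by rewrite divr_gt0// exprn_gt0.
  have := gx n; rewrite /g -hx WP normrM normfV (gtr0_norm (z0 n)) ler_pdivlMr//.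
  move=> /le_trans/(_ (hilbert_cauchy_schwarz _ _)) h1.
  have {}h1 := le_trans h1 (ler_wpM2l (rnorm_ge0 _) (ltW (zP n))).
  have qz : 0 < 3^-1 ^+ n.+1 / 2 * rnorm (z n) by rewrite mulr_gt0.
  rewrite -(ler_pM2r qz); move: h1.
  have -> : rnorm h * (c n * rnorm (z n)) =
      rnorm h * (3^-1 ^+ n.+1 / 2 * rnorm (z n)) / n.+1%:R by rewrite /c; ring.
  by rewrite ler_pdivlMr// mulrC.
by have := hn (Num.truncn (rnorm h)); rewrite leNgt truncnS_gt.
Qed.

(** The orthogonal complement of [ker V] is the range of [W]: the vector [u] representing [f] is
    projected onto that range, and the remainder [w] is shown to vanish. *)
Lemma kernel_functional_representable (f : H -> R) k : real_linear f ->
  (forall h, f h <= k * rnorm h) -> (forall h, V h = 0 -> f h = 0) ->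
  exists a, forall h, f h = re_form BE (V h) a.
Proof.
move=> fL fk fker; have [u uP] := riesz_rnorm fL fk.
have [W WP] := surj_adjoint; have [c c0 cW] := adjoint_bounded_below WP.
have [s s0 Vs] := rnorm_bounded V_bounded.
have EF := re_form_real BE; have HF := re_form_real ip.
have Ws z : rnorm (W z) <= s * rnorm z.
  have := krein_cauchy_schwarz E_krein (V (W z)) z.
  rewrite WP re_ip_norm ger0_norm ?sqr_ge0// expr2.
  have [->|W0 h] := eqVneq (rnorm (W z)) 0; first by
    rewrite mulr_ge0 ?rnorm_ge0// ltW.
  have {}W0 : 0 < rnorm (W z) by rewrite lt0r W0 rnorm_ge0.
  rewrite -(ler_pM2l W0); apply: le_trans h _.
  by rewrite mulrA (mulrC (rnorm (W z))) ler_wpM2r ?rnorm_ge0.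
pose G z z' := re_form ip (W z) (W z').
have GF : real_form G.
  (* [W] was chosen pointwise; its linearity is read off from that of [[V h, z]] in [z]. *)
  split=> [z r x y|x y]; last exact: HF.2.
  by rewrite /G ![re_form ip _ (W z)]HF.2 -!WP (real_formr _ EF).
(* The bounds [c |z| <= |W z| <= s |z|] make [G] equivalent to the squared norm of [E]. *)
have Gcomplete : cauchy_complete (fun z => G z z).
  move=> v vc; have [e e0|l vl] := krein_complete E_krein (u := v).
    have ce0 : 0 < c ^+ 2 * e by rewrite mulr_gt0// exprn_gt0.
    apply: filterS (vc _ ce0) => -[m n] /=; rewrite /G re_ip_norm => vmn.
    rewrite -(ltr_pM2l (exprn_gt0 2 c0)); apply: le_lt_trans vmn.
    by rewrite -exprMn ler_sqr ?nnegrE ?rnorm_ge0 ?mulr_ge0 ?rnorm_ge0// ltW.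
  exists l => e e0; have es0 : 0 < e / s ^+ 2 by rewrite divr_gt0// exprn_gt0.
  apply: filterS (vl _ es0) => n; rewrite ltr_pdivlMr ?exprn_gt0// => vln.
  rewrite /G re_ip_norm; apply: le_lt_trans vln; rewrite mulrC -exprMn.
  by rewrite ler_sqr ?nnegrE ?rnorm_ge0 ?mulr_ge0 ?rnorm_ge0// ltW.
have G0 z : 0 <= G z z by rewrite /G re_ip_norm sqr_ge0.
have uL : real_linear (fun z => re_form ip (W z) u).
  by move=> r x y; rewrite ![re_form ip _ u]HF.2 -!WP (real_formr _ EF).
have uG z : 2 * re_form ip (W z) u <= G z z + rnorm u ^+ 2.
  by rewrite /G re_ip_norm hilbert_young.
have [a aP] := riesz GF G0 Gcomplete uL uG.
pose w := u - W a.
have ipW z : re_form ip w (W z) = 0.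
  by rewrite /w HF.2 (real_linearB (real_formr _ HF)) aP subrr.
(* Since [w] is orthogonal to the range of [W], [V w] pairs to zero with everything, in particular
   with [J (V w)]. *)
have Vw : V w = 0.
  have [J JP] := krein_symmetry E_krein.
  apply: rnorm0_eq0; apply/eqP; rewrite -sqrf_eq0 -(JP _).2 EF.2 WP.
  by rewrite ipW.
(* [<w, w> = <w, u> - <w, W a> = f w], and [f] vanishes on [ker V]. *)
have w0 : w = 0.
  apply: rnorm0_eq0; apply/eqP; rewrite -sqrf_eq0 -re_ip_norm.
  by rewrite {2}/w (real_linearB (real_formr _ HF)) ipW subr0 -uP fker.
by exists a => h; rewrite uP WP; congr re_form; apply/eqP; rewrite -subr_eq0 -/w w0.
Qed.

End SurjectiveOperator.

(** * First-order conditions and the shape of spline sets *)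

Section Splines.
Variables (R : realType) (H K E : normedModType R[i]).
Variables (BK : {hermitian_sym K for Num.conj}).
Variables (BE : {hermitian_sym E for Num.conj}).
Variables (T : {linear H -> K}) (V : {linear H -> E}) (rho : R).
Hypothesis RL_pos :
  positive_subspace (form_rho BK BE rho) (range (pair_op T V)).

Definition same_data (x : H) : set H := [set y | T y = T x /\ V y = V x].

(** The quadratic form of [form_rho] pulled back along [pair_op T V]. *)
Let q h := re_form BK (T h) (T h) + rho * re_form BE (V h) (V h).

Lemma positive_range_le0 h : q h <= 0 -> T h = 0 /\ V h = 0.
Proof.
move=> qh; apply: contrapT => h0.
have Lh : pair_op T V h != 0 by apply/eqP => -[Th Vh]; apply: h0.
have : 0 < form_rho BK BE rho (pair_op T V h) (pair_op T V h).
  by apply: RL_pos.2 => //; exists h.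
by rewrite /form_rho /= !herm_real -rmorphM -rmorphD (ltcR 0) ltNge qh.
Qed.

Lemma positive_range_ge0 h : 0 <= q h.
Proof.
rewrite leNgt; apply/negP => qh; have [Th Vh] := positive_range_le0 (ltW qh).
move: qh; rewrite /q Th Vh (real_linear0 ((re_form_real BK).1 _)).
rewrite (real_linear0 ((re_form_real BE).1 _)) mulr0 addr0.
by rewrite ltxx.
Qed.

Let phi z0 x :=
  re_form BK (T x) (T x) + rho * re_form BE (V x - z0) (V x - z0).

Lemma smoothing_splinesE z0 x :
  smoothing_splines BK BE rho T V z0 x <-> forall y, phi z0 x <= phi z0 y.
Proof.
rewrite /smoothing_splines /minimizers /=.
split=> [[_ h] y|h].
  by have := h y I; rewrite !herm_real -!rmorphM -!rmorphD lecR.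
by split=> // y _; rewrite !herm_real -!rmorphM -!rmorphD lecR; exact: h.
Qed.

Lemma interpolating_splinesE w0 x :
  interpolating_splines BK T V w0 x <->
  V x = w0 /\ forall y, V y = w0 -> re_form BK (T x) (T x) <= re_form BK (T y) (T y).
Proof.
rewrite /interpolating_splines /minimizers /=.
by split=> -[Vx h]; split=> // y Vy; have := h y Vy; rewrite !herm_real lecR.
Qed.

(** On each real line through [x] the functional is quadratic with leading coefficient [q h >= 0],
    so a vanishing derivative is equivalent to a global minimum. *)
Lemma smoothing_first_order z0 x :
  smoothing_splines BK BE rho T V z0 x <->
  forall h, re_form BK (T h) (T x) + rho * re_form BE (V h) (V x - z0) = 0.
Proof.
have KF := re_form_real BK; have EF := re_form_real BE.
have phiD r h : phi z0 (x + r%:C *: h) = phi z0 x + (2 * r *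
    (re_form BK (T h) (T x) + rho * re_form BE (V h) (V x - z0)) + r ^+ 2 * q h).
  rewrite /phi /q !linearD !linearZ /= addrAC !real_form_expand//.
  by rewrite (KF.2 (T x) (T h)) (EF.2 _ (V h)); ring.
rewrite smoothing_splinesE; split=> [xmin h|x0 y].
  apply: (@quadratic_min _ _ (q h)) => r.
  by have := xmin (x + r%:C *: h); rewrite phiD lerDl.
have -> : y = x + 1%:C *: (y - x) by rewrite scale1r addrC subrK.
by rewrite phiD x0 mulr0 add0r expr1n mul1r lerDl positive_range_ge0.
Qed.

(** Admissible directions lie in [ker V], where [q h] reduces to [[T h, T h]], which is therefore
    nonnegative. *)
Lemma interpolating_first_order w0 x :
  interpolating_splines BK T V w0 x <->
  V x = w0 /\ forall h, V h = 0 -> re_form BK (T h) (T x) = 0.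
Proof.
have KF := re_form_real BK; have EF := re_form_real BE.
have qD r h : re_form BK (T (x + r%:C *: h)) (T (x + r%:C *: h)) =
    re_form BK (T x) (T x) +
    (2 * r * re_form BK (T h) (T x) + r ^+ 2 * re_form BK (T h) (T h)).
  by rewrite linearD linearZ /= real_form_expand// (KF.2 (T x) (T h)) addrA.
rewrite interpolating_splinesE; split=> -[Vx xmin]; split=> //.
  move=> h Vh; apply: (@quadratic_min _ _ (re_form BK (T h) (T h))) => r.
  have := xmin (x + r%:C *: h); rewrite qD lerDl; apply.
  by rewrite linearD linearZ /= Vh scaler0 addr0.
move=> y Vy; have -> : y = x + 1%:C *: (y - x) by rewrite scale1r addrC subrK.
have V0 : V (y - x) = 0 by rewrite linearB /= Vy Vx subrr.
rewrite qD (xmin _ V0) mulr0 add0r expr1n mul1r lerDl.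
have := positive_range_ge0 (y - x).
by rewrite /q V0 (real_linear0 (EF.1 _)) mulr0 addr0.
Qed.

Lemma smoothing_splines_same_data z0 x : smoothing_splines BK BE rho T V z0 x ->
  smoothing_splines BK BE rho T V z0 = same_data x.
Proof.
have KF := re_form_real BK; have EF := re_form_real BE.
move=> xsm; apply/seteqP; split=> y /=; last first.
  move=> [Ty Vy]; apply/smoothing_splinesE => h.
  by rewrite /phi Ty Vy; apply: (smoothing_splinesE _ _).1.
move=> ysm; have [|Th Vh] := @positive_range_le0 (y - x); last first.
  by split; apply/eqP; rewrite -subr_eq0 -linearB ?Th ?Vh.
(* Subtracting the two conditions in the direction [y - x] cancels [z0] and leaves
   [q (y - x) = 0]. *)
have := (smoothing_first_order _ _).1 xsm (y - x).
have := (smoothing_first_order _ _).1 ysm (y - x).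
have TB : T (y - x) = T y - T x by rewrite linearB.
have VB : V (y - x) = (V y - z0) - (V x - z0) by rewrite linearB /= opprB subrKA.
rewrite /q {4}TB {4}VB (real_linearB (real_formr _ KF)).
rewrite (real_linearB (real_formr _ EF)); lra.
Qed.

Lemma interpolating_splines_same_data w0 x : interpolating_splines BK T V w0 x ->
  interpolating_splines BK T V w0 = same_data x.
Proof.
have KF := re_form_real BK; have EF := re_form_real BE.
move=> xsp; have [Vx xmin] := (interpolating_first_order _ _).1 xsp.
apply/seteqP; split=> y /=; last first.
  move=> [Ty Vy]; apply/interpolating_first_order.
  by split=> [|h Vh]; rewrite ?Vy ?Ty ?xmin.
move=> /interpolating_first_order[Vy ymin].
have V0 : V (y - x) = 0 by rewrite linearB /= Vy Vx subrr.
have [|Th _] := @positive_range_le0 (y - x).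
  rewrite /q V0 (real_linear0 (EF.1 _)) mulr0 addr0.
  have {2}-> : T (y - x) = T y - T x by rewrite linearB.
  by rewrite (real_linearB (real_formr _ KF)) xmin// ymin// subrr.
by split; [apply/eqP; rewrite -subr_eq0 -linearB Th | rewrite Vx].
Qed.

End Splines.

(** * Correspondence of smoothing and interpolating splines *)

Theorem corollary4p9 (R : realType)
  (H : completeNormedModType R[i]) (ip : {dot H for Num.conj})
  (K : normedModType R[i]) (BK : {hermitian_sym K for Num.conj})
  (E : normedModType R[i]) (BE : {hermitian_sym E for Num.conj})
  (T : {linear H -> K}) (V : {linear H -> E}) (rho : R)
  (H_hilbert : inner_product_norm ip) (H_separable : separable H)
  (K_krein : krein_space BK) (E_krein : krein_space BE)
  (T_bounded : bounded_operator T) (T_surj : set_surj [set: H] [set: K] T)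
  (V_bounded : bounded_operator V) (V_surj : set_surj [set: H] [set: E] V)
  (rho_neq0 : rho != 0)
  (RL_pos : positive_subspace (form_rho BK BE rho) (range (pair_op T V)))
  (RL_nondeg :
     nondegenerate_subspace (form_rho BK BE rho) (range (pair_op T V))) :
  (forall z0 : E, smoothing_splines BK BE rho T V z0 !=set0 ->
     exists w0 : E, interpolating_splines BK T V w0 !=set0 /\
       interpolating_splines BK T V w0 = smoothing_splines BK BE rho T V z0)
  /\
  (forall w0 : E, interpolating_splines BK T V w0 !=set0 ->
     exists z0 : E,
       interpolating_splines BK T V w0 = smoothing_splines BK BE rho T V z0).
Proof.
(* One common point makes the two spline sets equal, both being its fibre. *)
have fibre w0 x : interpolating_splines BK T V w0 x ->
    forall z0, smoothing_splines BK BE rho T V z0 x ->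
    interpolating_splines BK T V w0 = smoothing_splines BK BE rho T V z0.
  move=> xsp z0 xsm; rewrite (interpolating_splines_same_data RL_pos xsp).
  by rewrite (smoothing_splines_same_data RL_pos xsm).
split=> [z0 [x xsm]|w0 [x xsp]].
  have xsp : interpolating_splines BK T V (V x) x.
    apply/(interpolating_first_order RL_pos); split=> // h Vh.
    have := (smoothing_first_order RL_pos _ _).1 xsm h.
    by rewrite Vh (real_linear0 ((re_form_real BE).1 _)) mulr0 addr0.
  by exists (V x); split; [exists x | exact: fibre xsp _ xsm].
have [_ xker] := (interpolating_first_order RL_pos _ _).1 xsp.
have [s s0 Ts] := rnorm_bounded T_bounded.
have [r h k||a aP] := kernel_functional_representable H_hilbert E_krein V_bounded
    V_surj (f := fun h => re_form BK (T h) (T x)) (k := s * rnorm (T x)) _ _ xker.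
- by rewrite linearP /= (re_form_real BK).1.
- move=> h; apply: le_trans (ler_norm _) _.
  apply: le_trans (krein_cauchy_schwarz K_krein _ _) _.
  by rewrite mulrAC ler_wpM2r ?rnorm_ge0.
(* With this [z0], [rho * (V x - z0) = - a], which cancels [[T h, T x] = [V h, a]]. *)
exists (V x + rho^-1%:C *: a); apply: (fibre _ _ xsp).
apply/(smoothing_first_order RL_pos) => h; rewrite aP opprD addNKr.
have BEr := real_formr (V h) (re_form_real BE).
by rewrite (real_linearN BEr) (real_linearZ BEr) mulrN mulVKf ?subrr.
Qed.
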